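(* Let $\Lambda$ be a good ordered commutative monoid, let $K_*=(K_\lambda)_{\lambda\in\Lambda}$ be a $\Lambda$-filtered group, and let $G$ be a group acting on the group $K_0$. For $\lambda\in\Lambda$ set $$G_\lambda=\{g\in G\mid [g^{\pm1},K_\mu]\subset K_{\lambda+\mu}\ \text{for all }\mu\in\Lambda\}.$$ Then $G_*=(G_\lambda)_{\lambda\in\Lambda}$ is a $\Lambda$-filtration of $G_0$ acting on $K_*$. Moreover, $G_*$ is the slowest decreasing $\Lambda$-filtration of $G_0$ acting on $K_*$; that is, if $G'_*$ is another $\Lambda$-filtration of $G_0$ acting on $K_*$, then $G'_\lambda\le G_\lambda$ for all $\lambda\in\Lambda$.
   Context: An ordered commutative monoid is a commutative monoid $(\Lambda,+,0)$ with a partial order $\le$ such that $\lambda\le\lambda'$ implies $\lambda+\mu\le\lambda'+\mu$. It is good if $0\le\lambda$ for all $\lambda\in\Lambda$ and if $\lambda<\lambda'$ implies $\lambda+\mu<\lambda'+\mu$. Put $\Lambda_+=\Lambda\setminus\{0\}$. A $\Lambda$-filtration of a group $K$ is a family $K_*=(K_\lambda)_{\lambda\in\Lambda}$ of normal subgroups of $K$ such that $K_0=K$, $K_\lambda\supset K_\mu$ whenever $\lambda\le\mu$, and $[K_\lambda,K_\mu]\subset K_{\lambda+\mu}$ for all $\lambda,\mu\in\Lambda$ (with $[a,b]=aba^{-1}b^{-1}$). A $\Lambda$-filtered group is a group with a $\Lambda$-filtration. If a group $G$ acts on a group $K$, then $G$ and $K$ are regarded as subgroups of $K\rtimes G$,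 so $[g,k]=g(k)k^{-1}\in K$ for $g\in G$, $k\in K$; $[g,S]\subset T$ means $[g,s]\in T$ for all $s\in S$. A $\Lambda$-filtered group $G_*$ (with $G_0$ acting on $K_0$) acts on $K_*$ if $[G_\lambda,K_\mu]\subset K_{\lambda+\mu}$ for all $\lambda,\mu\in\Lambda$; equivalently, $g(K_\mu)=K_\mu$ for all $g\in G_0$ and $\mu\in\Lambda$, and $[G_\lambda,K_\mu]\subset K_{\lambda+\mu}$ for all $\lambda\in\Lambda_+$, $\mu\in\Lambda$. *)

(* Defs.v *)
From HB Require Import structures.
From mathcomp Require Import all_boot all_order ssralg.
From mathcomp Require Import boolp classical_sets.

Set Implicit Arguments.
Unset Strict Implicit.
Unset Printing Implicit Defensive.

Import Order.TTheory GRing.Theory.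

Local Open Scope classical_set_scope.
Local Open Scope group_scope.

HB.mixin Record isOrderedNmodule (d : Order.disp_t) L
    of GRing.Nmodule L & Order.POrder d L := {
  leomD2r : forall x y z : L, (x <= y)%O -> ((x + z)%R <= (y + z)%R :> L)%O
}.

#[short(type="orderedNmodType")]
HB.structure Definition OrderedNmodule (d : Order.disp_t) :=
  { L of GRing.Nmodule L & Order.POrder d L & isOrderedNmodule d L }.

Definition good (d : Order.disp_t) (L : orderedNmodType d) : Prop :=
  (forall x : L, (0%R <= x)%O) /\
  (forall x y z : L, (x < y)%O -> ((x + z)%R < (y + z)%R)%O).

(* The convention is [a, b] = a b a^-1 b^-1; the library's [~ a, b] is
   a^-1 b^-1 a b. *)
Definition commutator (G : groupType) (a b : G) : G := a * b * a^-1 * b^-1.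

(* H is intended to be a subgroup of the ambient group G. *)
Definition normal_subgroup (G : groupType) (H N : set G) : Prop :=
  [/\ group_closed [in N], N `<=` H &
      forall h x : G, H h -> N x -> N (h * x * h^-1)].

(* Filtrations of a subgroup H of G, so that a filtration of a subgroup of G
   can be handled without changing the carrier; a filtration of the group G
   itself is a filtration of [set: G]. *)
Definition filtration (d : Order.disp_t) (L : orderedNmodType d)
    (G : groupType) (H : set G) (F : L -> set G) : Prop :=
  group_closed [in H] /\
  [/\ forall l : L, normal_subgroup H (F l),
      F 0%R = H,
      forall l m : L, (l <= m)%O -> F m `<=` F l &
      forall (l m : L) (a b : G),
        F l a -> F m b -> F (l + m)%R (commutator a b)].

Definition group_action (G K : groupType) (act : G -> K -> K) : Prop :=
  [/\ forall k : K, act 1 k = k,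
      forall (g h : G) (k : K), act (g * h) k = act g (act h k) &
      forall g : G, {morph act g : x y / x * y}].

(* The commutator [g, k] = g k g^-1 k^-1 computed in the semidirect product
   of K and G, where g k g^-1 = act g k. *)
Definition act_commutator (G K : groupType) (act : G -> K -> K)
  (g : G) (k : K) : K := act g k * k^-1.

Definition filtration_acts (d : Order.disp_t) (L : orderedNmodType d)
    (G K : groupType) (act : G -> K -> K)
    (GF : L -> set G) (KF : L -> set K) : Prop :=
  forall (l m : L) (g : G) (k : K),
    GF l g -> KF m k -> KF (l + m)%R (act_commutator act g k).

Definition induced_filtration (d : Order.disp_t) (L : orderedNmodType d)
    (G K : groupType) (act : G -> K -> K) (KF : L -> set K) (l : L) : set G :=
  [set g : G | forall (m : L) (k : K), KF m k ->
     KF (l + m)%R (act_commutator act g k) /\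
     KF (l + m)%R (act_commutator act g^-1 k)].

(* Main.v *)
(** That the commutator [[a, b]] shifts by [l + m] is the three subgroup lemma
    in the semidirect product, made explicit: on [k = b a k'], with
    [b k' = y k'] and [a k' = x k'], one has
    [[[a, b], k] = [a, y] [y, x] [b, x]^-1]. *)
Require Import Defs.
From mathcomp Require Import all_boot all_order ssralg.
From mathcomp Require Import boolp classical_sets.

Set Implicit Arguments.
Unset Strict Implicit.
Unset Printing Implicit Defensive.

Import GRing.Theory.

Local Open Scope classical_set_scope.

(** Translates the boolean predicate [[in N]] of the library into [Prop]-valued membership, so that
    subgroup conditions can be used on plain sets. *)
Lemma group_closed_setP (G : groupType) (N : set G) :
  group_closed [in N] <->
  N 1%g /\ (forall x y : G, N x -> N y -> N (x * y^-1)%g).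
Proof.
split=> -[N1 Nd]; split=> [|x y].
- by move: N1; rewrite inE.
- by move=> Nx Ny; apply: set_mem; apply: Nd; apply: mem_set.
- exact: mem_set.
- by move=> /set_mem Nx /set_mem Ny; apply: mem_set; apply: Nd.
Qed.

Section Commutator.
Local Open Scope group_scope.

Lemma commutatorV (G : groupType) (a b : G) :
  (commutator a b)^-1 = commutator b a.
Proof. by rewrite /commutator !invgM !invgK !mulgA. Qed.

Variables (G K : groupType) (act : G -> K -> K).
Hypothesis act_action : group_action act.

Local Notation "[~~ g , k ]" := (act_commutator act g k) (at level 0).

Lemma action1 k : act 1 k = k.
Proof. by case: act_action. Qed.

Lemma actionM g h k : act (g * h) k = act g (act h k).
Proof. by case: act_action. Qed.

Lemma action_morphM g : {morph act g : x y / x * y}.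
Proof. by case: act_action. Qed.

Lemma action_morphV g : {morph act g : x / x^-1}.
Proof.
move=> x; have g1 : act g 1 = 1.
  by apply: (mulgI (act g 1)); rewrite -action_morphM !mulg1.
by apply: (mulgI (act g x)); rewrite -action_morphM !mulgV.
Qed.

Lemma actionE g k : act g k = [~~ g, k] * k.
Proof. by rewrite /act_commutator mulgVK. Qed.

Lemma act_commutator1 k : [~~ 1, k] = 1.
Proof. by rewrite /act_commutator action1 mulgV. Qed.

(** Telescoping through [act h k]. With [act h k] as an argument, no factor is conjugated: it is
    enough that [h] preserves the filtration of [K]. *)
Lemma act_commutatorM g h k : [~~ g * h, k] = [~~ g, act h k] * [~~ h, k].
Proof. by rewrite /act_commutator actionM mulgA mulgVK. Qed.

(** In the semidirect product [act h] is conjugation by [h], and conjugation distributes over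
    commutators. *)
Lemma act_commutatorJ g h k :
  [~~ h * g * h^-1, k] = act h [~~ g, act h^-1 k].
Proof.
rewrite /act_commutator action_morphM action_morphV !actionM.
by rewrite -(actionM h h^-1 k) mulgV action1.
Qed.

Lemma act_commutator_commutator a b k (k' := act (a^-1 * b^-1) k)
    (x := [~~ a, k']) (y := [~~ b, k']) :
  [~~ commutator a b, k] = [~~ a, y] * commutator y x * [~~ b, x]^-1.
Proof.
have ak' : act a k' = x * k' by rewrite -actionE.
have bk' : act b k' = y * k' by rewrite -actionE.
(* Since [k' = a^-1 b^-1 k], one has [k = b a k'] and [[a, b] k = a b k']: the two orders of
   applying [a] and [b] to [k'] are compared. *)
have kE : k = act b x * act b k'.
  by rewrite -action_morphM -ak' -!actionM !mulgA mulgK mulgV action1.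
have abk : act (commutator a b) k = act a y * act a k'.
  by rewrite -action_morphM -bk' -!actionM /commutator !mulgA.
(* Now [[a, b] k] reads [[a, y] y x k'] and [k] reads [[b, x] x y k']; in the quotient [k']
   cancels. *)
rewrite {1}/act_commutator abk {1}kE ak' bk' (actionE a y) (actionE b x).
move: {ak' bk' kE abk} (x) (y) (k') => p q r.
by move: [~~ a, q] [~~ b, p] => u v; rewrite /commutator !invgM !mulgA mulgK.
Qed.

End Commutator.

Section InducedFiltration.
Local Open Scope group_scope.
Variables (d : Order.disp_t) (L : orderedNmodType d).
Hypothesis L_ge0 : forall l : L, (0%R <= l)%O.
Variables (G K : groupType) (KF : L -> set K) (act : G -> K -> K).
Hypothesis KF_filtration : filtration [set: K] KF.
Hypothesis act_action : group_action act.

Local Notation GF := (induced_filtration act KF).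
Local Notation "[~~ g , k ]" := (act_commutator act g k) (at level 0).

Lemma KF_closed l : group_closed [in KF l].
Proof. by case: KF_filtration => _ [/(_ l)[]]. Qed.

Lemma KF1 l : KF l 1.
Proof. by have /group_closed_setP[] := KF_closed l. Qed.

Lemma KFV l x : KF l x -> KF l x^-1.
Proof.
have /group_closed_setP[N1 Nd] := KF_closed l.
by move=> Nx; rewrite -[x^-1]mul1g; apply: Nd.
Qed.

Lemma KFM l x y : KF l x -> KF l y -> KF l (x * y).
Proof.
have /group_closed_setP[_ Nd] := KF_closed l.
by move=> Nx /KFV Ny; rewrite -[y]invgK; apply: Nd.
Qed.

Lemma KFS l m : (l <= m)%O -> KF m `<=` KF l.
Proof. by case: KF_filtration => _ [_ _ + _]; apply. Qed.

Lemma KF_commutator l m a b :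
  KF l a -> KF m b -> KF (l + m)%R (commutator a b).
Proof. by case: KF_filtration => _ [_ _ _]; apply. Qed.

(** One sign of the condition defining [GF l]. Closure properties are proved for this half and then
    applied to an element and to its inverse. *)
Definition shifts (l : L) (g : G) : Prop :=
  forall (m : L) (k : K), KF m k -> KF (l + m)%R [~~ g, k].

Lemma induced_filtrationP l g : GF l g <-> shifts l g /\ shifts l g^-1.
Proof.
split=> [Gg | [s sV] m k km].
  by split=> m k /Gg[].
by split; [apply: s | apply: sV].
Qed.

Lemma shiftsS l m g : (l <= m)%O -> shifts m g -> shifts l g.
Proof. by move=> lm s n k /s; apply: KFS; apply: leomD2r. Qed.

(** As [0 <= l], a shift by [l] is also a shift by [0], so both factors of [act g k = [g, k] k] lie
    in [KF m]. *)
Lemma shifts_stable l m g k : shifts l g -> KF m k -> KF m (act g k).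
Proof.
move=> /(shiftsS (L_ge0 l)) s km; rewrite actionE; apply: KFM => //.
by have := s m k km; rewrite add0r.
Qed.

Lemma shifts1 l : shifts l 1.
Proof. by move=> m k _; rewrite act_commutator1 //; apply: KF1. Qed.

Lemma shiftsM l g h : shifts l g -> shifts l h -> shifts l (g * h).
Proof.
move=> sg sh m k km; rewrite act_commutatorM //.
by apply: KFM; [apply/sg/(shifts_stable sh) | apply: sh].
Qed.

Lemma shiftsJ l g h :
  shifts 0%R h -> shifts 0%R h^-1 -> shifts l g -> shifts l (h * g * h^-1).
Proof.
move=> sh shV sg m k km; rewrite act_commutatorJ //.
exact/(shifts_stable sh)/sg/(shifts_stable shV).
Qed.

(** The conditions on [a^-1] and [b^-1] keep [k' = a^-1 b^-1 k] in [KF n]. The outer factors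
    [[a, y]] and [[b, x]] then result from two successive shifts, by [l] and by [m]. *)
Lemma shifts_commutator l m a b :
    shifts l a -> shifts l a^-1 -> shifts m b -> shifts m b^-1 ->
  shifts (l + m)%R (commutator a b).
Proof.
move=> sa saV sb sbV n k kn; rewrite act_commutator_commutator //.
set k' := act _ k.
have k'n : KF n k'.
  by rewrite /k' actionM //; apply/(shifts_stable saV)/(shifts_stable sbV).
have xln := sa n k' k'n; have ymn := sb n k' k'n.
apply: KFM; first apply: KFM.
- by have := sa _ _ ymn; rewrite addrA.
(* The middle factor [[y, x]] lies deeper than required, by a further [n]; since [0 <= n], it also
   lies in [KF (l + m + n)]. *)
- apply: KFS (KF_commutator ymn xln).
  have -> : (m + n + (l + n) = n + (l + m + n))%R.
    by rewrite addrACA [(m + l)%R]addrC [RHS]addrC addrA.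
  by rewrite -{1}[(l + m + n)%R]add0r; apply: leomD2r.
- by apply: KFV; have := sb _ _ xln; rewrite addrCA addrA.
Qed.

Lemma induced_filtration_closed l : group_closed [in GF l].
Proof.
apply/group_closed_setP; split=> [|g h].
  by apply/induced_filtrationP; rewrite invg1; split; apply: shifts1.
move=> /induced_filtrationP[sg sgV] /induced_filtrationP[sh shV].
(* The inverse of [g * h^-1] is [h * g^-1], so both halves concern products. *)
by apply/induced_filtrationP; rewrite invgM invgK; split; apply: shiftsM.
Qed.

Lemma induced_filtrationS l m : (l <= m)%O -> GF m `<=` GF l.
Proof.
move=> lm g /induced_filtrationP[s sV].
by apply/induced_filtrationP; split; apply: shiftsS lm _.
Qed.

Lemma induced_filtration_normal l : normal_subgroup (GF 0%R) (GF l).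
Proof.
split; [exact: induced_filtration_closed|exact: induced_filtrationS|].
move=> h g /induced_filtrationP[sh shV] /induced_filtrationP[sg sgV].
apply/induced_filtrationP.
by rewrite !invgM invgK mulgA; split; apply: shiftsJ.
Qed.

Lemma induced_filtration_filtration : filtration (GF 0%R) GF.
Proof.
split; first exact: induced_filtration_closed.
split=> [l|//|l m|l m a b]; first exact: induced_filtration_normal.
  exact: induced_filtrationS.
move=> /induced_filtrationP[sa saV] /induced_filtrationP[sb sbV].
(* The inverse of [[a, b]] is [[b, a]], which shifts by [m + l]; hence the commutation of the sum in
   the second half alone. *)
by apply/induced_filtrationP; rewrite commutatorV [in X in _ /\ X]addrC;
  split; apply: shifts_commutator.
Qed.

Lemma induced_filtration_acts : filtration_acts act GF KF.
Proof. by move=> l m g k Gg /Gg[]. Qed.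

(** Each [GF' l] is a subgroup, so it contains [g^-1] along with [g], and the action condition for
    both is membership in [GF l]. *)
Lemma induced_filtration_max (H : set G) (GF' : L -> set G) :
  filtration H GF' -> filtration_acts act GF' KF ->
  forall l : L, GF' l `<=` GF l.
Proof.
move=> [_ [GF'_normal _ _ _]] GF'_acts l g Gg.
have [/group_closed_setP[G1 Gd] _ _] := GF'_normal l.
have GgV : GF' l g^-1 by rewrite -[g^-1]mul1g; apply: Gd.
by move=> m k km; split; apply: GF'_acts.
Qed.

End InducedFiltration.

Theorem proposition2p6 (d : Order.disp_t) (L : orderedNmodType d)
    (L_good : good L)
    (K : groupType) (KF : L -> set K) (KF_filtration : filtration [set: K] KF)
    (G : groupType) (act : G -> K -> K) (act_action : group_action act) :
  let GF : L -> set G := induced_filtration act KF in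
  [/\ filtration (GF 0%R) GF,
      filtration_acts act GF KF &
      forall GF' : L -> set G,
        filtration (GF 0%R) GF' -> filtration_acts act GF' KF ->
        forall l : L, GF' l `<=` GF l].
Proof.
case: L_good => L_ge0 _ GF; split.
- exact: induced_filtration_filtration.
- exact: induced_filtration_acts.
- by move=> GF'; apply: induced_filtration_max.
Qed.
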